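(* Let $S=(R,E)$ be an abstract rewriting system modulo. If $(f,g)$ and $(f',g')$ are branchwise $E$-congruent $S$-branchings, then $(f,g)$ is confluent if and only if $(f',g')$ is confluent.
   Context: A 1-polygraph on a set $X$ is a set of arrows with source and target maps $s,t$ to $X$. An abstract rewriting system modulo $S=(R,E)$ is a pair of 1-polygraphs on the same set $X$. An $E$-congruence is a morphism of the free groupoid $E^\top$ generated by $E$; $x\sim_Ey$ means there is one from $x$ to $y$. An $S$-rewriting step is a composite $e'\circ r\circ e$ with $r\in R$ and $e,e'\in E^\top$. An $S$-rewriting sequence is either an $E$-congruence or a finite composite of $S$-rewriting steps. An $S$-branching is a pair $(f,g)$ of $S$-rewriting sequences with the same source; it is confluent if there are $S$-rewriting sequences $f',g'$ with $s(f')=t(f)$, $s(g')=t(g)$ and $t(f')=t(g')$. Two $S$-branchings $(f,g)$ and $(f',g')$ are branchwise $E$-congruent if they have the same source and there are $E$-congruences $t(f)\sim_Et(f')$ and $t(g)\sim_Et(g')$. *)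

(* Defs.v *)
From mathcomp Require Import all_boot.
From mathcomp Require Import boolp.

Set Implicit Arguments.
Unset Strict Implicit.
Unset Printing Implicit Defensive.

Local Open Scope quotient_scope.

Record polygraph (X : Type) : Type := Polygraph {
  arrow :> Type;
  asrc : arrow -> X;
  atgt : arrow -> X }.

Record arsm (X : Type) : Type := Arsm {
  rules : polygraph X;       (* R *)
  congruences : polygraph X  (* E *) }.

(* Composites are written in diagrammatic order throughout: [comp f g] is
   "g after f". *)

Section FreeGroupoid.
Variables (X : Type) (E : polygraph X).

(* Unreduced words in the arrows of [E] and their formal inverses. *)
Inductive zigzag : X -> X -> Type :=
| ZNil x : zigzag x x
| ZFwd (a : E) y : zigzag (atgt a) y -> zigzag (asrc a) y
| ZBwd (a : E) y : zigzag (asrc a) y -> zigzag (atgt a) y.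

(* The congruence generated by a^-1 a = 1 and a a^-1 = 1.  Closure under
   prefixing by one letter suffices: closure under suffixes is [zeq_catl]. *)
Inductive zeq : forall x y, zigzag x y -> zigzag x y -> Prop :=
| zeq_refl x y (p : zigzag x y) : zeq p p
| zeq_sym x y (p q : zigzag x y) : zeq p q -> zeq q p
| zeq_trans x y (p q r : zigzag x y) : zeq p q -> zeq q r -> zeq p r
| zeq_fwd (a : E) y (p q : zigzag (atgt a) y) : zeq p q -> zeq (ZFwd p) (ZFwd q)
| zeq_bwd (a : E) y (p q : zigzag (asrc a) y) : zeq p q -> zeq (ZBwd p) (ZBwd q)
| zeq_fwdbwd (a : E) y (p : zigzag (asrc a) y) : zeq (ZFwd (ZBwd p)) p
| zeq_bwdfwd (a : E) y (p : zigzag (atgt a) y) : zeq (ZBwd (ZFwd p)) p.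

Fixpoint zcat x y z (p : zigzag x y) : zigzag y z -> zigzag x z :=
  match p with
  | ZNil _ => fun q => q
  | ZFwd _ _ p' => fun q => ZFwd (zcat p' q)
  | ZBwd _ _ p' => fun q => ZBwd (zcat p' q)
  end.

Fixpoint zinv x y (p : zigzag x y) : zigzag y x :=
  match p in zigzag x y return zigzag y x with
  | ZNil x => ZNil x
  | ZFwd a _ p' => zcat (zinv p') (ZBwd (ZNil (asrc a)))
  | ZBwd a _ p' => zcat (zinv p') (ZFwd (ZNil (atgt a)))
  end.

Definition zeqb x y : rel {classic zigzag x y} := fun p q => `[< zeq p q >].

Lemma zeqb_refl x y : reflexive (@zeqb x y).
Proof. by move=> p; apply/asboolP; exact: zeq_refl. Qed.

Lemma zeqb_sym x y : symmetric (@zeqb x y).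
Proof. by move=> p q; apply/asboolP/asboolP; exact: zeq_sym. Qed.

Lemma zeqb_trans x y : transitive (@zeqb x y).
Proof.
by move=> q p r /asboolP pq /asboolP qr; apply/asboolP; exact: zeq_trans qr.
Qed.

Definition zeq_equiv x y :=
  EquivRel (@zeqb x y) (@zeqb_refl x y) (@zeqb_sym x y) (@zeqb_trans x y).

(* Hom-sets of the free groupoid on [E]. *)
Definition fgrpd (x y : X) : Type := {eq_quot (zeq_equiv x y)}.

Definition zclass x y (p : zigzag x y) : fgrpd x y :=
  \pi_({eq_quot (zeq_equiv x y)}) (p : {classic zigzag x y}).

Definition zrepr x y (e : fgrpd x y) : zigzag x y :=
  repr (e : {eq_quot (zeq_equiv x y)}).

Definition fgrpd_id x : fgrpd x x := zclass (ZNil x).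

Definition fgrpd_comp x y z (e : fgrpd x y) (e' : fgrpd y z) : fgrpd x z :=
  zclass (zcat (zrepr e) (zrepr e')).

Definition fgrpd_inv x y (e : fgrpd x y) : fgrpd y x :=
  zclass (zinv (zrepr e)).

Lemma zclassP x y (p q : zigzag x y) : zclass p = zclass q <-> zeq p q.
Proof.
split=> [/eqmodP/asboolP //|pq].
by apply/eqmodP/asboolP.
Qed.

Lemma zreprK x y (e : fgrpd x y) : zclass (zrepr e) = e.
Proof. exact: reprK. Qed.

Lemma zeq_zrepr x y (p : zigzag x y) : zeq (zrepr (zclass p)) p.
Proof. by apply/zclassP; rewrite zreprK. Qed.

Lemma zcatA x y z t (p : zigzag x y) (q : zigzag y z) (r : zigzag z t) :
  zcat (zcat p q) r = zcat p (zcat q r).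
Proof. by elim: p q => //= [a y' p IH|a y' p IH] q; rewrite IH. Qed.

Lemma zcatp0 x y (p : zigzag x y) : zcat p (ZNil y) = p.
Proof. by elim: p => //= [a y' p ->|a y' p ->]. Qed.

Lemma zeq_catl x y z (p p' : zigzag x y) (q : zigzag y z) :
  zeq p p' -> zeq (zcat p q) (zcat p' q).
Proof.
move=> pp'; elim: pp' q => {x y p p'} /=.
- by move=> *; exact: zeq_refl.
- by move=> x y p p' _ IH q; apply: zeq_sym; exact: IH.
- by move=> x y p1 p2 p3 _ IH1 _ IH2 q; apply: zeq_trans (IH1 q) (IH2 q).
- by move=> a y p p' _ IH q; apply: zeq_fwd; exact: IH.
- by move=> a y p p' _ IH q; apply: zeq_bwd; exact: IH.
- by move=> *; exact: zeq_fwdbwd.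
- by move=> *; exact: zeq_bwdfwd.
Qed.

Lemma zeq_catr x y z (p : zigzag x y) (q q' : zigzag y z) :
  zeq q q' -> zeq (zcat p q) (zcat p q').
Proof.
elim: p q q' => //= [a y' p IH|a y' p IH] q q' qq'.
  by apply: zeq_fwd; exact: IH.
by apply: zeq_bwd; exact: IH.
Qed.

Lemma zeq_catpV x y (p : zigzag x y) : zeq (zcat p (zinv p)) (ZNil x).
Proof.
elim: p => [x'|a y' p IH|a y' p IH] /=; first exact: zeq_refl.
- rewrite -zcatA; apply: zeq_trans (zeq_fwdbwd _).
  by apply: zeq_fwd; exact: zeq_catl IH.
- rewrite -zcatA; apply: zeq_trans (zeq_bwdfwd _).
  by apply: zeq_bwd; exact: zeq_catl IH.
Qed.

Lemma zeq_catVp x y (p : zigzag x y) : zeq (zcat (zinv p) p) (ZNil y).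
Proof.
elim: p => [x'|a y' p IH|a y' p IH] /=; first exact: zeq_refl.
- rewrite zcatA /=; apply: zeq_trans IH.
  by apply: zeq_catr; exact: zeq_bwdfwd.
- rewrite zcatA /=; apply: zeq_trans IH.
  by apply: zeq_catr; exact: zeq_fwdbwd.
Qed.

Lemma fgrpd_compE x y z (p : zigzag x y) (q : zigzag y z) :
  fgrpd_comp (zclass p) (zclass q) = zclass (zcat p q).
Proof.
apply/zclassP; apply: zeq_trans (zeq_catl _ (zeq_zrepr p)) _.
exact: zeq_catr (zeq_zrepr q).
Qed.

Lemma fgrpd_compA x y z t (e : fgrpd x y) (f : fgrpd y z) (g : fgrpd z t) :
  fgrpd_comp (fgrpd_comp e f) g = fgrpd_comp e (fgrpd_comp f g).
Proof.
by rewrite -(zreprK e) -(zreprK f) -(zreprK g) !fgrpd_compE zcatA.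
Qed.

Lemma fgrpd_comp1e x y (e : fgrpd x y) : fgrpd_comp (fgrpd_id x) e = e.
Proof. by rewrite -(zreprK e) fgrpd_compE. Qed.

Lemma fgrpd_compe1 x y (e : fgrpd x y) : fgrpd_comp e (fgrpd_id y) = e.
Proof. by rewrite -(zreprK e) fgrpd_compE zcatp0. Qed.

Lemma fgrpd_compeV x y (e : fgrpd x y) :
  fgrpd_comp e (fgrpd_inv e) = fgrpd_id x.
Proof.
by rewrite -{1}(zreprK e) fgrpd_compE; apply/zclassP; exact: zeq_catpV.
Qed.

Lemma fgrpd_compVe x y (e : fgrpd x y) :
  fgrpd_comp (fgrpd_inv e) e = fgrpd_id y.
Proof.
by rewrite -{2}(zreprK e) fgrpd_compE; apply/zclassP; exact: zeq_catVp.
Qed.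

End FreeGroupoid.

Definition E_congruent (X : Type) (S : arsm X) (x y : X) : Prop :=
  exists _ : fgrpd (congruences S) x y, True.

Section Rewriting.
Variables (X : Type) (S : arsm X).
Notation R := (rules S).
Notation Etop := (fgrpd (congruences S)).

(* The category in which S-rewriting steps are composed: the coproduct, over
   the fixed object set X, of the free category on R and the free groupoid on
   E.  As the free category on R has no non-trivial relations, each morphism
   is uniquely an alternating composite  e_n o r_n o ... o r_1 o e_0  with
   r_i in R and e_i (possibly an identity) in the free groupoid. *)
Inductive rwmor : X -> X -> Type :=
| RWCong x y : Etop x y -> rwmor x y
| RWCons x (r : R) y : Etop x (asrc r) -> rwmor (atgt r) y -> rwmor x y.

Definition rwprecomp x y z (e : Etop x y) (f : rwmor y z) : rwmor x z :=
  match f in rwmor y z return Etop x y -> rwmor x z with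
  | RWCong _ _ e' => fun e => RWCong (fgrpd_comp e e')
  | RWCons _ _ _ e' f' => fun e => RWCons (fgrpd_comp e e') f'
  end e.

Fixpoint rwcomp x y z (f : rwmor x y) : rwmor y z -> rwmor x z :=
  match f with
  | RWCong _ _ e => fun g => rwprecomp e g
  | RWCons _ _ _ e f' => fun g => RWCons e (rwcomp f' g)
  end.

Definition rwid x : rwmor x x := RWCong (fgrpd_id (congruences S) x).

Definition rwrule (r : R) : rwmor (asrc r) (atgt r) :=
  RWCons (fgrpd_id (congruences S) (asrc r)) (rwid (atgt r)).

Lemma rwcomp1f x y (f : rwmor x y) : rwcomp (rwid x) f = f.
Proof. by case: f => * /=; rewrite fgrpd_comp1e. Qed.

Lemma rwcompf1 x y (f : rwmor x y) : rwcomp f (rwid y) = f.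
Proof. by elim: f => [x' y' e|x' r y' e f IH] /=; rewrite ?fgrpd_compe1 ?IH. Qed.

Lemma rwprecomp_comp x y z t (e : Etop x y) (g : rwmor y z) (h : rwmor z t) :
  rwcomp (rwprecomp e g) h = rwprecomp e (rwcomp g h).
Proof.
case: g e h => [y' z' e'|y' r z' e' g] e h //=.
by case: h e' => [? ? e''|? ? ? e'' h] e' /=; rewrite fgrpd_compA.
Qed.

Lemma rwcompA x y z t (f : rwmor x y) (g : rwmor y z) (h : rwmor z t) :
  rwcomp (rwcomp f g) h = rwcomp f (rwcomp g h).
Proof.
by elim: f g => [x' y' e|x' r y' e f IH] g /=; rewrite ?rwprecomp_comp ?IH.
Qed.

(* e' o r o e *)
Definition is_step x y (f : rwmor x y) : Prop :=
  exists (r : R) (e : Etop x (asrc r)) (e' : Etop (atgt r) y),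
    f = rwcomp (rwcomp (RWCong e) (rwrule r)) (RWCong e').

(* Nonempty composites; the empty one is the identity E-congruence. *)
Inductive is_step_composite : forall x y, rwmor x y -> Prop :=
| step_composite1 x y (f : rwmor x y) : is_step f -> is_step_composite f
| step_compositeS x y z (f : rwmor x y) (g : rwmor y z) :
    is_step f -> is_step_composite g -> is_step_composite (rwcomp f g).

Definition is_rewriting_sequence x y (f : rwmor x y) : Prop :=
  (exists e : Etop x y, f = RWCong e) \/ is_step_composite f.

Record rwseq : Type := RwSeq {
  rwsrc : X;
  rwtgt : X;
  rwhom : rwmor rwsrc rwtgt;
  rwhomP : is_rewriting_sequence rwhom }.

Record branching : Type := Branching {
  brL : rwseq;
  brR : rwseq;
  brP : rwsrc brL = rwsrc brR }.

Definition confluent (b : branching) : Prop :=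
  exists f' g' : rwseq,
    [/\ rwsrc f' = rwtgt (brL b), rwsrc g' = rwtgt (brR b)
      & rwtgt f' = rwtgt g'].

Definition branchwise_congruent (b b' : branching) : Prop :=
  [/\ rwsrc (brL b) = rwsrc (brL b'),
      E_congruent S (rwtgt (brL b)) (rwtgt (brL b'))
    & E_congruent S (rwtgt (brR b)) (rwtgt (brR b'))].

End Rewriting.

(* Main.v *)
Require Import Defs.
From mathcomp Require Import ssreflect ssrfun ssrbool.

Set Implicit Arguments.
Unset Strict Implicit.
Unset Printing Implicit Defensive.

(** Precomposing a rewriting sequence with an E-congruence e gives a rewriting
    sequence again, as e is absorbed by the first congruence or step.  So
    sequences closing one branching close the other after precomposition with
    the inverses of the congruences between the targets. *)

Lemma E_congruent_sym (X : Type) (S : arsm X) (x y : X) :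
  E_congruent S x y -> E_congruent S y x.
Proof. by case=> e _; exists (fgrpd_inv e). Qed.

Lemma branchwise_congruent_sym (X : Type) (S : arsm X) (b b' : branching S) :
  branchwise_congruent b b' -> branchwise_congruent b' b.
Proof. by case=> eq_src eL eR; split=> //; exact: E_congruent_sym. Qed.

Section Precomposition.
Variables (X : Type) (S : arsm X).
Notation Etop := (fgrpd (congruences S)).

Lemma is_step_rwprecomp x y z (e : Etop x y) (f : rwmor S y z) :
  is_step f -> is_step (rwprecomp e f).
Proof.
case=> r [e0 [e1 ->]]; exists r, (fgrpd_comp e e0), e1.
(* [rwprecomp e] moves inward through both composites until it meets [RWCong e0], where it computes
   to [RWCong (fgrpd_comp e e0)]. *)
by rewrite -!rwprecomp_comp.
Qed.

(** Only the first step absorbs [e] and the tail stays as it is, so a case analysis replaces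
    induction. *)
Lemma is_step_composite_rwprecomp x y z (e : Etop x y) (f : rwmor S y z) :
  is_step_composite f -> is_step_composite (rwprecomp e f).
Proof.
move=> fP; case: fP e => {y z f} [y z f fP e|y t z f g fP gP e].
  by apply: step_composite1; exact: is_step_rwprecomp.
rewrite -rwprecomp_comp; apply: step_compositeS gP.
exact: is_step_rwprecomp.
Qed.

Lemma is_rewriting_sequence_rwprecomp x y z (e : Etop x y) (f : rwmor S y z) :
  is_rewriting_sequence f -> is_rewriting_sequence (rwprecomp e f).
Proof.
case=> [[e' ->]|fP]; first by left; exists (fgrpd_comp e e').
by right; exact: is_step_composite_rwprecomp.
Qed.

(** Moves the start of a closing sequence along a congruence while keeping the point where the two
    closing sequences meet. *)
Lemma rwseq_congruent_src (f : rwseq S) (x : X) :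
  E_congruent S x (rwsrc f) ->
  exists f' : rwseq S, rwsrc f' = x /\ rwtgt f' = rwtgt f.
Proof.
case=> e _.
by exists (RwSeq (is_rewriting_sequence_rwprecomp e (rwhomP f))).
Qed.

Lemma confluent_branchwise_congruent (b b' : branching S) :
  branchwise_congruent b b' -> confluent b -> confluent b'.
Proof.
case=> _ eL eR [f [g [srcf srcg eq_tgt]]].
(* Since [f] starts where the left branch of [b] ends, the reversed congruence runs from the end of
   the left branch of [b'] to the source of [f]. *)
have := E_congruent_sym eL; rewrite -srcf => /rwseq_congruent_src[f' [srcf' tgtf']].
have := E_congruent_sym eR; rewrite -srcg => /rwseq_congruent_src[g' [srcg' tgtg']].
by exists f', g'; split; rewrite // tgtf' tgtg'.
Qed.

End Precomposition.

Theorem mainTheorem8 (X : Type) (S : arsm X) (b b' : branching S) :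
  branchwise_congruent b b' -> (confluent b <-> confluent b').
Proof.
move=> bb'; split; apply: confluent_branchwise_congruent => //.
exact: branchwise_congruent_sym.
Qed.
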